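(* Let $L:\mathbb{R}^n\times\mathbb{R}^m\to[-\infty,+\infty]$ be such that $L(\cdot,\lambda)$ is convex and lower semicontinuous for every $\lambda\in\mathbb{R}^m$ and $L(x,\cdot)$ is concave and upper semicontinuous for every $x\in\mathbb{R}^n$. Let $P\in\mathbb{R}^{(n+m)\times(n+m)}$ be a (symmetric) positive semidefinite matrix, let $z^0=(x^0,\lambda^0)\in\mathbb{R}^{n+m}$, and let $z^k=(x^k,\lambda^k)\in\mathbb{R}^{n+m}$, $k\ge 1$, be iterates satisfying $$P(z^k-z^{k+1})\in\mathcal{F}(z^{k+1})\qquad\text{for all } k\ge 0 .$$ Set $\bar z^k=(\bar x^k,\bar\lambda^k)=\frac1k\sum_{i=1}^k z^i$. Then for every $k\ge 1$ and every $z=(x,\lambda)\in\mathbb{R}^n\times\mathbb{R}^m$, $$L(\bar x^k,\lambda)-L(x,\bar\lambda^k)\le\frac{\|z-z^0\|_P^2}{2k}.$$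
   Context: The problem considered is the convex-concave primal-dual problem $\min_{x\in\mathbb{R}^n}\max_{\lambda\in\mathbb{R}^m}L(x,\lambda)$. For $z=(x,\lambda)$, $$\mathcal{F}(z)=\begin{pmatrix}\partial_xL(x,\lambda)\\-\partial_\lambda L(x,\lambda)\end{pmatrix},$$ where $\partial_xL(x,\lambda)$ is the convex subdifferential of $L(\cdot,\lambda)$ at $x$ and $-\partial_\lambda L(x,\lambda)$ is the convex subdifferential of $-L(x,\cdot)$ at $\lambda$; subdifferentials are taken only at points where $L$ is finite (so $\mathcal{F}(z)=\emptyset$ if $L(z)$ is not finite). For a positive semidefinite matrix $P$, $\|z\|_P^2=z^TPz$. *)

(* Defs.v *)
From HB Require Import structures.
From mathcomp Require Import all_boot all_order all_algebra.
From mathcomp Require Import all_classical all_reals all_analysis.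

Set Implicit Arguments.
Unset Strict Implicit.
Unset Printing Implicit Defensive.

Import Order.TTheory GRing.Theory Num.Theory.
Import numFieldNormedType.Exports.

Local Open Scope classical_set_scope.
Local Open Scope ring_scope.

Definition dotv (R : realType) (d : nat) (u v : 'cV[R]_d) : R := (u^T *m v) 0 0.

Definition sqnorm_mx (R : realType) (d : nat) (P : 'M[R]_d) (z : 'cV[R]_d) : R :=
  (z^T *m P *m z) 0 0.

Definition possemidef (R : realType) (d : nat) (P : 'M[R]_d) : Prop :=
  P^T = P /\ forall z : 'cV[R]_d, 0 <= sqnorm_mx P z.

Definition epigraph (R : realType) (d : nat) (f : 'cV[R]_d -> \bar R) :
  set ('cV[R]_d * R^o) := [set p | (f p.1 <= p.2%:E)%E].

(* Convexity of a function with values in [-oo, +oo] is convexity of its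
   epigraph, so that the sum +oo + -oo never has to be given a value. *)
Definition econvex (R : realType) (d : nat) (f : 'cV[R]_d -> \bar R) : Prop :=
  convex_set (epigraph f).

Definition econcave (R : realType) (d : nat) (f : 'cV[R]_d -> \bar R) : Prop :=
  econvex (fun x => - f x)%E.

Definition upper_semicontinuous (R : realType) (d : nat)
    (f : 'cV[R]_d -> \bar R) : Prop :=
  lower_semicontinuous (fun x => - f x)%E.

Definition subdiff (R : realType) (d : nat) (f : 'cV[R]_d -> \bar R)
    (x : 'cV[R]_d) : set 'cV[R]_d :=
  [set g | f x \is a fin_num /\
           forall y, (f x + (dotv g (y - x))%:E <= f y)%E].

Definition saddle_subdiff (R : realType) (n m : nat)
    (L : 'cV[R]_n -> 'cV[R]_m -> \bar R) (z : 'cV[R]_(n + m)) :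
    set 'cV[R]_(n + m) :=
  [set w | subdiff (fun x => L x (dsubmx z)) (usubmx z) (usubmx w) /\
           subdiff (fun l => - L (usubmx z) l)%E (dsubmx z) (dsubmx w)].

Definition avg_iter (R : realType) (d : nat) (z : nat -> 'cV[R]_d) (k : nat) :
  'cV[R]_d := k%:R^-1 *: \sum_(1 <= i < k.+1) z i.

(* Main.v *)
Require Import Defs.
From HB Require Import structures.
From mathcomp Require Import all_boot all_order all_algebra.
From mathcomp Require Import all_classical all_reals all_analysis.
From mathcomp Require Import ring lra.

(** Write [w = P (z^i - z^(i+1))].  The
    inclusion [w \in F (z^(i+1))] consists of two subgradient inequalities at
    [z^(i+1)], where [L] is finite.  Adding them, the value [L (z^(i+1))]
    cancels and for every [z = (x, l)]
      [L (x^(i+1)) l - L x (l^(i+1)) <= <w, z^(i+1) - z>].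
    Expanding squares ([dotv_psd_le]) and dropping [|z^i - z^(i+1)|_P^2 >= 0] bounds the right
    side by [(|z^i - z|_P^2 - |z^(i+1) - z|_P^2) / 2], which telescopes when it
    is summed.  Jensen's inequality for the convex functions [L _ l] and
    [- L x _] turns the average of the left sides into the gap at the averaged
    iterates.

    The only delicate point is that [L (x^(i+1)) l] and [L x (l^(i+1))] may be
    infinite.  The two subgradient inequalities bound [L (x^(i+1)) l] and
    [- L x (l^(i+1))] separately from above by real numbers
    ([saddle_subdiff_le]), so Jensen's inequality is only ever applied to points
    of an epigraph ([econvex_mean]).  The same upper bounds survive averaging,
    and they exclude [oo - oo] in the conclusion. *)

Set Implicit Arguments.
Unset Strict Implicit.
Unset Printing Implicit Defensive.

Import Order.TTheory GRing.Theory Num.Theory.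
Import numFieldNormedType.Exports.

Local Open Scope classical_set_scope.
Local Open Scope ring_scope.

Lemma convex_set_mean (R : numFieldType) (M : lmodType R)
    (A : set (convex_lmodType M)) (p : nat -> M) (k : nat) :
  convex_set A -> (forall i, A (p i)) -> (0 < k)%N ->
  A (k%:R^-1 *: \sum_(0 <= i < k) p i).
Proof.
move=> cA Ap; elim: k => // -[_ _|k IHk _].
  by rewrite big_nat1 invr1 scale1r.
(* The mean of [k + 2] points has weight [1 / (k + 2)] on the last one, the
   rest being on the mean of the first [k + 1]. *)
have t01 : 0 <= (k.+2%:R^-1 : R) <= 1.
  by rewrite invr_ge0 ler0n invf_le1 ?ltr0n// ler1n.
pose t : {i01 R} := Itv01 (andP t01).1 (andP t01).2.
have := cA (p k.+1) (k.+1%:R^-1 *: \sum_(0 <= i < k.+1) p i) t.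
rewrite !inE => /(_ (Ap _) (IHk isT)); congr A.
rewrite [in RHS]big_nat_recr//= scalerDr addrC; congr (_ + _).
rewrite /conv/= scalerA; congr (_ *: _).
by rewrite /= /unstable.onem; field; rewrite !gt_eqF ?ltr_wpDr ?ltr0n.
Qed.

(** Jensen's inequality for equal weights.  Real upper bounds [a] stand in for
    the values of [f], which may be [-oo]; this is what averaging points of the
    epigraph gives. *)
Lemma econvex_mean (R : realType) (d : nat) (f : 'cV[R]_d -> \bar R)
    (x : nat -> 'cV[R]_d) (a : nat -> R) (k : nat) :
  econvex f -> (forall i, (f (x i) <= (a i)%:E)%E) -> (0 < k)%N ->
  (f (k%:R^-1 *: \sum_(0 <= i < k) x i)
     <= (k%:R^-1 * \sum_(0 <= i < k) a i)%:E)%E.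
Proof.
move=> cf fa k0.
have := convex_set_mean (p := fun i => (x i, a i : R^o)) cf fa k0.
rewrite /epigraph/=.
rewrite (big_morph fst (id1 := 0) (op1 := +%R))//.
by rewrite (big_morph snd (id1 := 0) (op1 := +%R)).
Qed.

Lemma avg_iterE (R : realType) (d : nat) (z : nat -> 'cV[R]_d) (k : nat) :
  avg_iter z k = k%:R^-1 *: \sum_(0 <= i < k) z i.+1.
Proof. by rewrite /avg_iter big_add1. Qed.

Lemma dotv_submx (R : realType) (n m : nat) (w v : 'cV[R]_(n + m)) :
  dotv w v = dotv (usubmx w) (usubmx v) + dotv (dsubmx w) (dsubmx v).
Proof.
rewrite /dotv -{1}(vsubmxK w) -{1}(vsubmxK v) tr_col_mx mul_row_col.
by rewrite mxE.
Qed.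

Lemma dotvN (R : realType) (d : nat) (w v : 'cV[R]_d) :
  dotv w (- v) = - dotv w v.
Proof. by rewrite /dotv mulmxN mxE. Qed.

Lemma sqnorm_mxN (R : realType) (d : nat) (P : 'M[R]_d) (v : 'cV[R]_d) :
  sqnorm_mx P (- v) = sqnorm_mx P v.
Proof. by rewrite /sqnorm_mx [(- v)^T]linearN/= mulmxN !mulNmx opprK. Qed.

(** The right side exceeds the left one by [|u|_P^2 / 2]. *)
Lemma dotv_psd_le (R : realType) (d : nat) (P : 'M[R]_d) (u v : 'cV[R]_d) :
  possemidef P ->
  dotv (P *m u) v <= (sqnorm_mx P (u + v) - sqnorm_mx P v) / 2.
Proof.
move=> [Psym Pge0]; have := Pge0 u.
have uPv : dotv (P *m u) v = (u^T *m P *m v) 0 0.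
  by rewrite /dotv trmx_mul Psym.
have vPu : (v^T *m P *m u) 0 0 = (u^T *m P *m v) 0 0.
  transitivity ((v^T *m P *m u)^T 0 0); first by rewrite [RHS]mxE.
  by rewrite !trmx_mul trmxK Psym mulmxA.
have entryD (A B : 'M[R]_1) : (A + B) 0 0 = A 0 0 + B 0 0 by rewrite mxE.
rewrite uPv /sqnorm_mx [(u + v)^T]linearD/= !(mulmxDl, mulmxDr) !entryD vPu.
lra.
Qed.

(** The two bounds are the subgradient inequalities in the directions [l] and
    [x].  The finite value of [L] at [z] enters them with opposite signs, so it
    drops out of their sum.  The bounds are kept apart because [L (usubmx z) l]
    may be [-oo] and [L x (dsubmx z)] may be [+oo]. *)
Lemma saddle_subdiff_le (R : realType) (n m : nat)
    (L : 'cV[R]_n -> 'cV[R]_m -> \bar R) (z w : 'cV[R]_(n + m))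
    (x : 'cV[R]_n) (l : 'cV[R]_m) :
  saddle_subdiff L z w ->
  exists ab : R * R, [/\ (L (usubmx z) l <= ab.1%:E)%E,
    (- L x (dsubmx z) <= ab.2%:E)%E &
    ab.1 + ab.2 = dotv w (z - col_mx x l)].
Proof.
move=> [[Lfin Lx] [_ Ll]]; move: (Lx x) (Ll l).
rewrite -(fineK Lfin); set c := fine _.
set s := dotv (usubmx w) _; set t := dotv (dsubmx w) _ => Lx' Ll'.
exists (c - t, - c - s); split => /=.
- move: Ll'; rewrite -EFinN -EFinD.
  by case: (L _ l) => [r| |] /=; rewrite ?(lee_fin, leNye, leeNy_eq)//; lra.
- move: Lx'; rewrite -EFinD.
  by case: (L x _) => [r| |] /=; rewrite ?(lee_fin, leNye, leeNy_eq)//; lra.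
- rewrite dotv_submx !linearB/= col_mxKu col_mxKd.
  rewrite -(opprB x) -(opprB l) !dotvN -/s -/t; ring.
Qed.

(* MathComp-Analysis world. The first conjunct of the conclusion says that the
   extended-real difference is well defined (not of the form oo - oo). *)
Theorem theorem1 (R : realType) (n m : nat)
  (L : 'cV[R]_n -> 'cV[R]_m -> \bar R)
  (L_convex : forall l : 'cV[R]_m, econvex (fun x => L x l))
  (L_lsc : forall l : 'cV[R]_m, lower_semicontinuous (fun x => L x l))
  (L_concave : forall x : 'cV[R]_n, econcave (fun l => L x l))
  (L_usc : forall x : 'cV[R]_n, upper_semicontinuous (fun l => L x l))
  (P : 'M[R]_(n + m)) (P_psd : possemidef P)
  (z : nat -> 'cV[R]_(n + m))
  (z_iter : forall k : nat,
     saddle_subdiff L (z k.+1) (P *m (z k - z k.+1)))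
  (k : nat) (k_ge1 : (1 <= k)%N)
  (x : 'cV[R]_n) (l : 'cV[R]_m) :
  let xbar := usubmx (avg_iter z k) in
  let lbar := dsubmx (avg_iter z k) in
  (L xbar l +? - L x lbar)%E /\
  (L xbar l - L x lbar
     <= (sqnorm_mx P (col_mx x l - z 0%N) / (2 * k%:R))%:E)%E.
Proof.
move=> xbar lbar; pose y := col_mx x l.
have {}z_iter i := saddle_subdiff_le x l (z_iter i).
have [ab abP] := choice z_iter.
have Lxbar : (L xbar l <= (k%:R^-1 * \sum_(0 <= i < k) (ab i).1)%:E)%E.
  rewrite /xbar avg_iterE linearZ linear_sum/=.
  apply: (econvex_mean (L_convex l)) => // i.
  by case: (abP i).
have Llbar : (- L x lbar <= (k%:R^-1 * \sum_(0 <= i < k) (ab i).2)%:E)%E.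
  rewrite /lbar avg_iterE linearZ linear_sum/=.
  apply: (econvex_mean (L_concave x)) => // i.
  by case: (abP i).
split.
  by apply: ltpinfty_adde_def; rewrite inE; apply: le_lt_trans (ltry _);
    [exact: Lxbar|exact: Llbar].
apply: le_trans (leeD Lxbar Llbar) _.
rewrite -EFinD lee_fin -mulrDr -big_split/=.
rewrite invfM mulrCA mulrA mulrC ler_wpM2r ?invr_ge0//.
rewrite mulrC.
(* The potential: half the squared distance to [y], negated so that it
   telescopes upwards. *)
pose e i := - (sqnorm_mx P (z i - y) / 2).
have : \sum_(0 <= i < k) ((ab i).1 + (ab i).2) <= e k - e 0%N.
  rewrite -(telescope_sumr e)//; apply: ler_sum => i _.
  have [_ _ ->] := abP i.
  apply: le_trans (dotv_psd_le _ _ P_psd) _.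
  by rewrite subrKA /e; lra.
move/le_trans; apply.
have := P_psd.2 (z k - y).
by rewrite /e -(opprB (z 0%N)) sqnorm_mxN; lra.
Qed.
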